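(* Let $\alpha>0$, $M=M'=(0,\infty)^n$, and let $\mathbf D$ be an $L^{(\alpha)}$-divergence, i.e. the $c$-divergence on a graph $G$ of optimal transport for the logarithmic cost $c(p,q')=\frac1\alpha\log(1+\alpha\,p\cdot q')$. Equip $G$ with the dualistic structure $(g,\nabla,\nabla^* )$ induced by $\mathbf D$. Let $\gamma(s)$ be a primal geodesic (a geodesic of $\nabla$) and $\sigma(t)$ a dual geodesic (a geodesic of $\nabla^*$) in $G$ with $\gamma(0)=\sigma(0)$. Then $$\frac{\partial^4}{\partial s^2\partial t^2}\mathbf D[\gamma(s):\sigma(t)]\Big|_{s=t=0}=-2\alpha\,g(\dot\gamma(0),\dot\sigma(0))^2 .$$
   Context: Here $n\ge2$ and $a\cdot b$ is the Euclidean dot product. Graph of optimal transport. $\varphi:M\to\mathbb R$ is smooth and $c$-concave, i.e. there is $\psi:M'\to\mathbb R\cup\{-\infty\}$ with $\varphi(p)=\inf_{q'\in M'}(c(p,q')-\psi(q'))$ for all $p\in M$. For each $p\in M$ there is a unique $q'=:D^c\varphi(p)\in M'$ with $\varphi(p)+\psi(q')=c(p,q')$, and $f=D^c\varphi$ is a smooth diffeomorphism from $M$ onto its range $f(M)\subset M'$. $\psi$ is the $c$-transform of $\varphi$: $\psi(q)=\inf_{p\in M}(c(p,q)-\varphi(p))$, so $\psi(q)=c(f^{-1}(q),q)-\varphi(f^{-1}(q))$ for $q\in f(M)$. The graph of optimal transport is $G=\{(p,f(p)):p\in M\}$, an $n$-dimensional embedded submanifold of $M\times M'$. $c$-divergence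 and dualistic structure. For $x=(p,q),\,x'=(p',q')\in G$, $\mathbf D[x:x']=c(p,q')-\varphi(p)-\psi(q')$. Using local coordinates $\xi$ of $M$ as coordinates on $G$ via $(p,f(p))\mapsto p$ and writing $\mathbf D=\mathbf D[\xi:\xi']$, define $g_{ij}(\xi)=-\frac{\partial}{\partial\xi^i}\frac{\partial}{\partial\xi'^j}\mathbf D\big|_{\xi'=\xi}$ (a Riemannian metric on $G$), $\Gamma_{ijk}(\xi)=-\frac{\partial^2}{\partial\xi^i\partial\xi^j}\frac{\partial}{\partial\xi'^k}\mathbf D\big|_{\xi'=\xi}$, $\Gamma^*_{ijk}(\xi)=-\frac{\partial^2}{\partial\xi'^i\partial\xi'^j}\frac{\partial}{\partial\xi^k}\mathbf D\big|_{\xi'=\xi}$. The torsion-free connections $\nabla,\nabla^*$ on $G$ have Christoffel symbols $\Gamma_{ij}{}^k=\Gamma_{ijm}g^{mk}$ and $\Gamma^*_{ij}{}^k=\Gamma^*_{ijm}g^{mk}$ (Einstein summation), with $\nabla_{\partial_i}\partial_j=\Gamma_{ij}{}^k\partial_k$ (similarly for $\nabla^*$). *)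

(* Defs.v *)
From HB Require Import structures.
From mathcomp Require Import all_boot all_order all_algebra.
From mathcomp Require Import all_classical all_reals all_analysis.

Set Implicit Arguments.
Unset Strict Implicit.
Unset Printing Implicit Defensive.

Import Order.TTheory GRing.Theory Num.Theory.
Import numFieldNormedType.Exports.

Local Open Scope classical_set_scope.
Local Open Scope ring_scope.

(* Continuity of all iterated directional derivatives up to order k.  This is
   the usual C^k for V of finite dimension and U open, the only case in which
   it is used. *)
Fixpoint Ck (R : realType) (V W : normedModType R) (k : nat)
    (U : set V) (F : V -> W) : Prop :=
  (forall x, U x -> {for x, continuous F}) /\
  match k with
  | 0 => True
  | k'.+1 => forall v : V,
      (forall x, U x -> derivable F x v) /\ Ck k' U ('D_v F)
  end.

Definition smooth_on (R : realType) (V W : normedModType R)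
    (U : set V) (F : V -> W) : Prop := forall k, Ck k U F.

Definition diffeo_onto_range (R : realType) (V W : normedModType R)
    (U : set V) (F : V -> W) : Prop :=
  [/\ smooth_on U F, open (F @` U) &
      exists h : W -> V, smooth_on (F @` U) h /\ {in U, cancel F h}].

Definition dotp (R : realType) (n : nat) (p q : 'rV[R]_n) : R :=
  \sum_(i < n) p 0 i * q 0 i.

Definition orthant (R : realType) (n : nat) : set 'rV[R]_n :=
  [set p | forall i, 0 < p 0 i].

Definition log_cost (R : realType) (n : nat) (alpha : R) (p q : 'rV[R]_n) : R :=
  alpha^-1 * ln (1 + alpha * dotp p q).

Definition c_concave (R : realType) (n : nat) (M M' : set 'rV[R]_n)
    (c : 'rV[R]_n -> 'rV[R]_n -> R) (phi : 'rV[R]_n -> R) : Prop :=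
  exists psi : 'rV[R]_n -> \bar R,
    (forall q, M' q -> psi q != +oo%E) /\
    (forall p, M p ->
       (phi p)%:E = ereal_inf [set ((c p q)%:E - psi q)%E | q in M']).

Definition c_transform (R : realType) (n : nat) (M : set 'rV[R]_n)
    (c : 'rV[R]_n -> 'rV[R]_n -> R) (phi : 'rV[R]_n -> R) (q : 'rV[R]_n) :
    \bar R :=
  ereal_inf [set (c p q - phi p)%:E | p in M].

(* phi is a smooth c-concave potential on M and f is its c-gradient D^c phi. *)
Definition optimal_transport (R : realType) (n : nat) (M M' : set 'rV[R]_n)
    (c : 'rV[R]_n -> 'rV[R]_n -> R) (phi : 'rV[R]_n -> R)
    (f : 'rV[R]_n -> 'rV[R]_n) : Prop :=
  [/\ smooth_on M phi,
      c_concave M M' c phi,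
      (forall p, M p ->
         [set q | M' q /\
            ((phi p)%:E + c_transform M c phi q)%E = (c p q)%:E] = [set f p]) &
      diffeo_onto_range M f].

Definition transport_graph (R : realType) (n : nat) (M : set 'rV[R]_n)
    (f : 'rV[R]_n -> 'rV[R]_n) : set ('rV[R]_n * 'rV[R]_n) :=
  [set (p, f p) | p in M].

(* D[x : x'].  The c-transform is finite at x'.2 when x' is on the graph, so
   that fine loses nothing there. *)
Definition c_divergence (R : realType) (n : nat) (M : set 'rV[R]_n)
    (c : 'rV[R]_n -> 'rV[R]_n -> R) (phi : 'rV[R]_n -> R)
    (x x' : 'rV[R]_n * 'rV[R]_n) : R :=
  c x.1 x'.2 - phi x.1 - fine (c_transform M c phi x'.2).

(* The divergence in the coordinates p of the point (p, f p) of the graph. *)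
Definition in_coords (R : realType) (n : nat) (f : 'rV[R]_n -> 'rV[R]_n)
    (D : 'rV[R]_n * 'rV[R]_n -> 'rV[R]_n * 'rV[R]_n -> R)
    (xi xi' : 'rV[R]_n) : R :=
  D (xi, f xi) (xi', f xi').

Definition partial (R : realType) (n : nat) (i : 'I_n) (F : 'rV[R]_n -> R)
    (x : 'rV[R]_n) : R :=
  'D_(delta_mx 0 i) F x.

Definition metric (R : realType) (n : nat)
    (D : 'rV[R]_n -> 'rV[R]_n -> R) (xi : 'rV[R]_n) : 'M[R]_n :=
  \matrix_(i, j)
    - partial i (fun x => partial j (fun x' => D x x') xi) xi.

Definition metric_pairing (R : realType) (n : nat)
    (D : 'rV[R]_n -> 'rV[R]_n -> R) (xi u v : 'rV[R]_n) : R :=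
  \sum_(i < n) \sum_(j < n) metric D xi i j * u 0 i * v 0 j.

(* The innermost derivative is taken in the argument with a single derivative,
   at the fixed point xi, which amounts to setting xi' = xi at the end. *)
Definition Gamma_low (R : realType) (n : nat)
    (D : 'rV[R]_n -> 'rV[R]_n -> R) (xi : 'rV[R]_n) (i j k : 'I_n) : R :=
  - partial i (partial j (fun x => partial k (fun x' => D x x') xi)) xi.

Definition Gamma_dual_low (R : realType) (n : nat)
    (D : 'rV[R]_n -> 'rV[R]_n -> R) (xi : 'rV[R]_n) (i j k : 'I_n) : R :=
  - partial i (partial j (fun x' => partial k (fun x => D x x') xi)) xi.

(* Gamma_ij^k, in the argument order i j k. *)
Definition Gamma (R : realType) (n : nat)
    (D : 'rV[R]_n -> 'rV[R]_n -> R) (xi : 'rV[R]_n) (i j k : 'I_n) : R :=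
  \sum_(m < n) Gamma_low D xi i j m * invmx (metric D xi) m k.

Definition Gamma_dual (R : realType) (n : nat)
    (D : 'rV[R]_n -> 'rV[R]_n -> R) (xi : 'rV[R]_n) (i j k : 'I_n) : R :=
  \sum_(m < n) Gamma_dual_low D xi i j m * invmx (metric D xi) m k.

(* Geodesic equation in coordinates, for a connection with Christoffel symbols
   Gam, on an open interval I. *)
Definition is_geodesic (R : realType) (n : nat)
    (Gam : 'rV[R]_n -> 'I_n -> 'I_n -> 'I_n -> R)
    (I : set R) (x : R -> 'rV[R]_n) : Prop :=
  smooth_on I x /\
  forall s, I s -> forall k : 'I_n,
    (derive1n 2 x s) 0 k +
    \sum_(i < n) \sum_(j < n)
      Gam (x s) i j k * (derive1 x s) 0 i * (derive1 x s) 0 j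
    = 0.

(* A curve in the graph over the open interval I which is a geodesic; its
   coordinate expression is its first component. *)
Definition geodesic_in_graph (R : realType) (n : nat) (M : set 'rV[R]_n)
    (f : 'rV[R]_n -> 'rV[R]_n)
    (Gam : 'rV[R]_n -> 'I_n -> 'I_n -> 'I_n -> R)
    (I : set R) (gamma : R -> 'rV[R]_n * 'rV[R]_n) : Prop :=
  [/\ open I, is_interval I,
      (forall s, I s -> transport_graph M f (gamma s)) &
      is_geodesic Gam I (fun s => (gamma s).1)].

(* Main.v *)
Require Import Defs.
From HB Require Import structures.
From mathcomp Require Import all_boot all_order all_algebra.
From mathcomp Require Import all_classical all_reals all_analysis.
From mathcomp Require Import ring.

Set Implicit Arguments.
Unset Strict Implicit.
Unset Printing Implicit Defensive.

Import Order.TTheory GRing.Theory Num.Theory.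
Import numFieldNormedType.Exports.

Local Open Scope classical_set_scope.
Local Open Scope ring_scope.

(* In D[gamma(s) : sigma(t)] only the cost c(x(s), q(t)) survives the mixed
   derivative; here x and q are the two components of the curves.  With
   P(s) = grad_q c (x(s), q(0)) = x(s) / (1 + alpha x(s).q(0)) one finds
     (d/dt)^2 c (x(s), q(t)) = P(s).q'' - alpha (P(s).q')^2   at t = 0.
   The metric and the Christoffel symbols of the primal connection are, up to
   the invertible Jacobian of f, first and second derivatives of grad_q c in p,
   so the primal geodesic equation at s = 0 is P''(0) = 0.  Hence the mixed
   fourth derivative is - 2 alpha (P'(0).q'(0))^2, and
   g(gamma', sigma') = - P'(0).q'(0). *)

(** * Differentiability from continuous partial derivatives *)

Lemma is_derive_line (R : realType) (V W : normedModType R) (F : V -> W)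
    (z v : V) (t : R) :
  derivable F (t *: v + z) v ->
  is_derive t 1 (fun s : R => F (s *: v + z)) ('D_v F (t *: v + z)).
Proof.
move=> dF.
have E : (fun h : R => h^-1 *: (((fun s : R => F (s *: v + z)) \o shift t) (h *: 1)
             - F (t *: v + z)))
       = (fun h => h^-1 *: ((F \o shift (t *: v + z)) (h *: v) - F (t *: v + z))).
  by apply/funext => h /=; rewrite [h%:A]mulr1 scalerDl addrA.
by apply: DeriveDef; rewrite /derivable /derive E.
Qed.

(** The mean value theorem on the segment from [z] to [c *: v + z]. The sign of [c] is left free
    because [c] will be a coordinate of an arbitrary small increment; the two orders of the
    endpoints are treated separately. *)
Lemma directional_MVT (R : realType) (V : normedModType R) (F : V -> R)
    (z v : V) (c : R) :
  (forall t : R, `|t| <= `|c| -> derivable F (t *: v + z) v) ->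
  exists2 t : R, `|t| <= `|c| & F (c *: v + z) - F z = 'D_v F (t *: v + z) * c.
Proof.
move=> dF; pose g (s : R) := F (s *: v + z).
have dg (t : R) : `|t| <= `|c| -> is_derive t 1 g ('D_v F (t *: v + z)).
  by move=> tc; exact/is_derive_line/dF.
have cg (A : set R) : (forall t, A t -> `|t| <= `|c|) -> {within A, continuous g}.
  move=> sA; apply: continuous_in_subspaceT => t /set_mem /sA /dg [dgt _].
  exact/differentiable_continuous/derivable1_diffP.
have g0 : g 0 = F z by rewrite /g scale0r add0r.
rewrite -/(g c) -g0; case: (ltgtP c 0) => [c0|c0|->]; last first.
- by exists 0; rewrite ?normr0// subrr mulr0.
- have le (t : R) : t \in `[0, c] -> `|t| <= `|c|.
    by rewrite in_itv/= => /andP[? ?]; rewrite !ger0_norm// ltW.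
  have [||t tc ->] := @MVT _ g (fun t => 'D_v F (t *: v + z)) 0 c c0.
  + by move=> t /subset_itv_oo_cc /le /dg.
  + by apply: cg => t /= /le.
  + by exists t; rewrite ?subr0//; apply/le/subset_itv_oo_cc.
- have le (t : R) : t \in `[c, 0] -> `|t| <= `|c|.
    rewrite in_itv/= => /andP[? ?]; rewrite !ler0_norm// ?lerN2//.
    exact: ltW.
  have [||t tc e] := @MVT _ g (fun t => 'D_v F (t *: v + z)) c 0 c0.
  + by move=> t /subset_itv_oo_cc /le /dg.
  + by apply: cg => t /= /le.
  + exists t; first exact/le/subset_itv_oo_cc.
    by rewrite -opprB e sub0r mulrN opprK.
Qed.

Lemma mx_norm_coord (R : realType) (m n : nat) (A : 'M[R]_(m, n)) i j :
  `|A i j| <= `|A|.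
Proof.
rewrite [leRHS]/Num.Def.normr/= mx_normrE.
exact: (le_bigmax _ (fun i => `|A i.1 i.2|) (i, j)).
Qed.

Lemma mx_norm_ler (R : realType) (m n : nat) (A : 'M[R]_(m, n)) (e : R) :
  0 <= e -> (forall i j, `|A i j| <= e) -> `|A| <= e.
Proof.
by move=> e0 Ae; rewrite [leLHS]/Num.Def.normr/= mx_normrE bigmax_le// => -[].
Qed.

(** Going from [x] to [x + h] one coordinate at a time, each increment is, by the mean value
    theorem, [h 0 i] times the [i]-th partial derivative at a point close to [x]. Continuity of the
    partials at [x] then makes the total error [o(h)]. *)
Lemma C1_differentiable (R : realType) (n : nat) (F : 'rV[R]_n -> R)
    (U : set 'rV[R]_n) (x : 'rV[R]_n) :
  open U -> U x ->
  (forall i y, U y -> derivable F y (delta_mx 0 i)) ->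
  (forall i, {for x, continuous ('D_(delta_mx 0 i) F)}) ->
  differentiable F x /\
  forall v, 'D_v F x = \sum_(i < n) v 0 i * 'D_(delta_mx 0 i) F x.
Proof.
move=> oU Ux dF cF; pose c i := 'D_(delta_mx 0 i) F x.
pose L (v : 'rV[R]_n) : R := \sum_(i < n) v 0 i * c i.
have L_lin : linear L.
  move=> a u v; rewrite /L scaler_sumr -big_split; apply: eq_bigr => i _ /=.
  by rewrite !mxE mulrDl -mulrA.
pose LM := GRing.isLinear.Build _ _ _ _ _ L_lin.
pose LL : {linear 'rV[R]_n -> R} := HB.pack L LM.
have L_cont : continuous LL.
  rewrite (_ : (LL : _ -> _) = \sum_(i < n) (fun v : 'rV[R]_n => v 0 i * c i)); last first.
    by apply/funext => v; rewrite fct_sumE.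
  apply: (@big_ind _ (fun g : 'rV[R]_n -> R => continuous g)).
  - exact: cst_continuous.
  - by move=> f g cf cg v; exact: (continuousD (cf v) (cg v)).
  - move=> i _ v; apply: (@continuousM _ _ (fun w : 'rV[R]_n => w 0 i) (cst (c i))).
      exact: coord_continuous.
    exact: cst_continuous.
pose F' : 'rV[R]_n -> R^o := F.
pose L' : 'rV[R]_n -> R^o := LL.
have oL : F' \o shift x = cst (F' x) + L' +o_ (0 : 'rV[R]_n) id.
  apply/(@eqaddoP R 'rV[R]_n R 'rV[R]_n) => _/posnumP[e].
  (* There are [n] errors to add up; dividing by [n.+1] rather than [n] also covers [n = 0]. *)
  have en0 : 0 < e%:num / n.+1%:R by rewrite divr_gt0.
  have : \forall y \near x, U y /\
      forall i, `|c i - 'D_(delta_mx 0 i) F y| <= e%:num / n.+1%:R.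
    apply: filterI; first exact: open_nbhs_nbhs.
    have near_i i : \forall y \near x, `|c i - 'D_(delta_mx 0 i) F y| <= e%:num / n.+1%:R.
      by move/cvgrPdist_le : (cF i) => /(_ _ en0).
    exact: filter_forall near_i.
  move/nbhs_ballP => [r /= r0 Hr].
  have small : \forall h \near (0 : 'rV[R]_n), `|h| < r.
    exact: (@nbhs0_lt R 'rV[R]_n).
  near=> h.
  have hr : `|h| < r by near: h; exact: small.
  (* [hk k] keeps the first [k] coordinates of [h], so the increments from [hk i] to [hk i.+1]
     telescope to the one from [0] to [h]. *)
  pose hk (k : nat) : 'rV[R]_n := \row_j (if (j < k)%N then h 0 j else 0).
  have hkS (i : 'I_n) : hk i.+1 = h 0 i *: delta_mx 0 i + hk i.
    apply/rowP => j; rewrite !mxE eqxx/= ltnS leq_eqVlt -val_eqE/=.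
    by case: ltngtP => //= [_|_|/val_inj ->]; rewrite ?mulr0 ?add0r ?mulr1 ?addr0.
  (* In the sup norm, the points between consecutive truncations of [h] are no larger than [h]
     itself, hence stay in the ball where the partials are controlled. *)
  have inball (i : 'I_n) (t : R) : `|t| <= `|h 0 i| ->
      ball x r (t *: delta_mx 0 i + (hk i + x)).
    move=> th; rewrite -ball_normE /ball_/= addrA opprD addrCA subrr addr0 normrN.
    apply: le_lt_trans hr; apply: mx_norm_ler => // a j.
    rewrite !mxE ord1/= -val_eqE.
    case: ltngtP => [ji|ij|_]; rewrite /= ?mulr0 ?add0r ?normr0// ?mulr1 ?addr0.
    - exact: mx_norm_coord.
    - by apply: (le_trans th); exact: mx_norm_coord.
  have step (i : 'I_n) :
      `|F (hk i.+1 + x) - F (hk i + x) - h 0 i * c i| <= e%:num / n.+1%:R * `|h|.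
    rewrite hkS -(addrA _ (hk i) x).
    have [t th|t th e1] := @directional_MVT R _ F (hk i + x) (delta_mx 0 i) (h 0 i).
      by apply: dF; have [] := Hr _ (inball _ _ th).
    rewrite e1 mulrC -mulrBr normrM mulrC ler_pM//; last exact: mx_norm_coord.
    by rewrite distrC; have [_] := Hr _ (inball _ _ th); exact.
  have hn : hk n = h by apply/rowP => j; rewrite !mxE ltn_ord.
  have h0 : hk 0%N = 0 by apply/rowP => j; rewrite !mxE.
  rewrite [X in `|X|](_ : _ =
      \sum_(i < n) (F (hk i.+1 + x) - F (hk i + x) - h 0 i * c i)); last first.
    rewrite sumrB -(big_mkord xpredT (fun i => F (hk i.+1 + x) - F (hk i + x))).
    by rewrite telescope_sumr// hn h0 add0r -addrA -opprD.
  apply: le_trans (ler_norm_sum _ _ _) _.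
  apply: le_trans (ler_sum _ (fun i _ => step i)) _.
  rewrite sumr_const card_ord -mulrnAl ler_wpM2r// -mulr_natr -mulrA.
  by rewrite ler_piMr// mulrC ler_pdivrMr// mul1r ler_nat.
have dE := diff_unique L_cont oL.
have dFx : differentiable F x.
  apply/diff_locallyP; rewrite dE; split => //.
by split=> // v; rewrite deriveE// dE.
Unshelve. all: by end_near. Qed.

(** * Differentiation rules for rows, dot products and the cost *)

Lemma is_derive_coord (R : realType) (V : normedModType R) (m n : nat)
    (X : V -> 'M[R]_(m, n)) (z v : V) (dX : 'M[R]_(m, n)) i j :
  is_derive z v X dX -> is_derive z v (fun y => X y i j) (dX i j).
Proof.
move=> [dXz <-]; rewrite derive_mx// mxE; apply: derivableP.
by move/derivable_mxP : dXz.
Qed.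

(** Only the derivative of [g] along [v] is available, so [g] is restricted to the line through [z]
    in direction [v], where the one-variable chain rule applies. *)
Lemma is_derive_chain (R : realType) (V : normedModType R) (g : V -> R)
    (h : R -> R) (z v : V) (dg dh : R) :
  is_derive z v g dg -> is_derive (g z) 1 h dh ->
  is_derive z v (fun y => h (g y)) (dh * dg).
Proof.
move=> [dgz <-] [dhz <-]; pose gl (s : R) := g (s *: v + z).
have gl0 : gl 0 = g z by rewrite /gl scale0r add0r.
have [dgl dglE] : is_derive (0 : R) 1 gl ('D_v g z).
  have := @is_derive_line R V R g z v 0; rewrite scale0r add0r => /(_ dgz) H.
  exact: H.
have dhl : derivable h (gl 0) 1 by rewrite gl0; exact: dhz.
have dhgl : derivable (h \o gl) 0 1.
  apply/derivable1_diffP; apply: differentiable_comp; apply/derivable1_diffP.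
    exact: dgl.
  exact: dhl.
have dhg : derivable (fun y => h (g y)) z v.
  by apply/derivable1P; exact: dhgl.
apply: DeriveDef; first exact: dhg.
have [_ dhgE] : is_derive (0 : R) 1 (h \o gl) ('D_v (fun y => h (g y)) z).
  have := @is_derive_line R V R (fun y => h (g y)) z v 0.
  rewrite scale0r add0r => /(_ dhg) H; exact: H.
rewrite -dhgE -derive1E derive1_comp; [|exact: dgl|exact: dhl].
by rewrite !derive1E dglE gl0.
Qed.

Lemma is_derive_dotp (R : realType) (V : normedModType R) (n : nat)
    (X Y : V -> 'rV[R]_n) (z v : V) (dX dY : 'rV[R]_n) :
  is_derive z v X dX -> is_derive z v Y dY ->
  is_derive z v (fun y => dotp (X y) (Y y)) (dotp dX (Y z) + dotp (X z) dY).
Proof.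
move=> hX hY.
have -> : (fun y => dotp (X y) (Y y))
        = \sum_(i < n) ((fun y => X y 0 i) * (fun y => Y y 0 i)).
  by apply/funext => y; rewrite fct_sumE.
rewrite /dotp -big_split; apply: is_derive_sum => i.
apply: (is_derive_eq (is_deriveM (is_derive_coord 0 i hX)
  (is_derive_coord 0 i hY))).
by rewrite addrC [X in X + _]mulrC.
Qed.

Lemma is_derive_dotpl (R : realType) (V : normedModType R) (n : nat)
    (X : V -> 'rV[R]_n) (q : 'rV[R]_n) (z v : V) (dX : 'rV[R]_n) :
  is_derive z v X dX ->
  is_derive z v (fun y => dotp (X y) q) (dotp dX q).
Proof.
move=> hX; have := @is_derive_dotp _ _ _ X (cst q) z v dX 0 hX (is_derive_cst _ _ _).
move=> h; apply: (is_derive_eq h).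
by rewrite [X in _ + X]big1 ?addr0// => i _; rewrite mxE mulr0.
Qed.

Lemma is_derive_log_cost (R : realType) (V : normedModType R) (n : nat)
    (alpha : R) (X Y : V -> 'rV[R]_n) (z v : V) (dX dY : 'rV[R]_n) :
  alpha != 0 -> 0 < 1 + alpha * dotp (X z) (Y z) ->
  is_derive z v X dX -> is_derive z v Y dY ->
  is_derive z v (fun y => log_cost alpha (X y) (Y y))
    ((dotp dX (Y z) + dotp (X z) dY) / (1 + alpha * dotp (X z) (Y z))).
Proof.
move=> a0 w0 hX hY.
have hw : is_derive z v (fun y => 1 + alpha * dotp (X y) (Y y))
    (alpha * (dotp dX (Y z) + dotp (X z) dY)).
  apply: (is_derive_eq (is_deriveD (is_derive_cst (1 : R) z v)
    (is_deriveZ alpha (is_derive_dotp hX hY)))).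
  by rewrite add0r.
have hl := @is_derive_chain _ _ _ (@ln R) _ _ _ _ hw (is_derive1_ln w0).
apply: (is_derive_eq (is_deriveZ alpha^-1 hl)).
by rewrite -[_ *: _]/(_ * _) mulrCA mulKf// mulrC.
Qed.

Lemma is_derive_quotient (R : realType) (V : normedModType R) (a w : V -> R)
    (z v : V) (da dw : R) :
  w z != 0 -> is_derive z v a da -> is_derive z v w dw ->
  is_derive z v (fun y => a y / w y) (da / w z - a z * dw / w z ^+ 2).
Proof.
move=> w0 ha [dwz dwE].
have hV : is_derive z v (fun y => (w y)^-1) (- (w z) ^- 2 * dw).
  apply: DeriveDef; first exact: derivableV.
  by rewrite deriveV// dwE.
apply: (is_derive_eq (is_deriveM ha hV)).
rewrite -![_ *: _]/(_ * _); field.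
by [].
Qed.

Lemma is_derive_row (R : realType) (V : normedModType R) (n : nat)
    (X : V -> 'rV[R]_n) (z v : V) (dX : 'rV[R]_n) :
  (forall i, is_derive z v (fun y => X y 0 i) (dX 0 i)) -> is_derive z v X dX.
Proof.
move=> hX; have dXz : derivable X z v.
  by apply/derivable_mxP => i j; rewrite ord1; have [] := hX j.
apply: DeriveDef; first exact: dXz.
rewrite derive_mx; last exact: dXz.
by apply/rowP => j; rewrite mxE; have [] := hX j.
Qed.

(** * The gradient of the cost in its second argument, and its first two derivatives *)

Section Gradient.
Variables (R : realType) (n : nat) (alpha : R) (q : 'rV[R]_n).

Definition log_arg (x : 'rV[R]_n) : R := 1 + alpha * dotp x q.

(* The gradient of the logarithmic cost in its second argument. *)
Definition qgrad (x : 'rV[R]_n) : 'rV[R]_n := (log_arg x)^-1 *: x.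

Definition dqgrad (x v : 'rV[R]_n) : 'rV[R]_n :=
  (log_arg x)^-1 *: v - (alpha * dotp v q / log_arg x ^+ 2) *: x.

(** The derivative of [dqgrad x v] in [x] along [u] with [v] held fixed, that is, the Hessian of
    [qgrad]; it is symmetric in [u] and [v]. *)
Definition d2qgrad (x u v : 'rV[R]_n) : 'rV[R]_n :=
  (2 * alpha ^+ 2 * dotp u q * dotp v q / log_arg x ^+ 3) *: x
  - (alpha * dotp u q / log_arg x ^+ 2) *: v
  - (alpha * dotp v q / log_arg x ^+ 2) *: u.

Lemma is_derive_log_arg (V : normedModType R) (X : V -> 'rV[R]_n) (z v : V)
    (dX : 'rV[R]_n) :
  is_derive z v X dX ->
  is_derive z v (fun y => log_arg (X y)) (alpha * dotp dX q).
Proof.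
move=> hX; apply: (is_derive_eq (is_deriveD (is_derive_cst (1 : R) z v)
  (is_deriveZ alpha (is_derive_dotpl q hX)))).
by rewrite add0r.
Qed.

Lemma is_derive_qgrad (V : normedModType R) (X : V -> 'rV[R]_n) (z v : V)
    (dX : 'rV[R]_n) :
  log_arg (X z) != 0 -> is_derive z v X dX ->
  is_derive z v (fun y => qgrad (X y)) (dqgrad (X z) dX).
Proof.
move=> w0 hX; apply: is_derive_row => i.
have := @is_derive_quotient R V (fun y => X y 0 i) (fun y => log_arg (X y))
  z v _ _ w0 (is_derive_coord 0 i hX) (is_derive_log_arg hX).
rewrite (_ : (fun y => X y 0 i / log_arg (X y)) = (fun y => qgrad (X y) 0 i)).
  by move=> h; apply: (is_derive_eq h); rewrite !mxE; field.
by apply/funext => y; rewrite !mxE mulrC.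
Qed.

(** The direction [A] may move: a constant [A] yields the Christoffel symbols, while [A] equal to
    the velocity of a curve [X] yields the second derivative of [qgrad] along [X]. *)
Lemma is_derive_dqgrad (V : normedModType R) (X A : V -> 'rV[R]_n) (z v : V)
    (dX dA : 'rV[R]_n) :
  log_arg (X z) != 0 -> is_derive z v X dX -> is_derive z v A dA ->
  is_derive z v (fun y => dqgrad (X y) (A y))
    (dqgrad (X z) dA + d2qgrad (X z) dX (A z)).
Proof.
move=> w0 hX hA; apply: is_derive_row => i.
have hw := is_derive_log_arg hX.
have hAi := is_derive_coord 0 i hA.
have hXi := is_derive_coord 0 i hX.
have h1 := @is_derive_quotient R V _ (fun y => log_arg (X y)) z v _ _ w0 hAi hw.
have hAq : is_derive z v (fun y => alpha * dotp (A y) q) (alpha * dotp dA q).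
  exact: is_deriveZ (is_derive_dotpl q hA).
have h2 := is_deriveM hAq hXi.
have w2 : ((fun y => log_arg (X y)) * (fun y => log_arg (X y))) z != 0.
  by rewrite mulf_neq0.
have h3 := is_derive_quotient w2 h2 (is_deriveM hw hw).
have := is_deriveB h1 h3.
rewrite [X in is_derive _ _ X](_ : _ = (fun y => dqgrad (X y) (A y) 0 i)).
  move=> h; apply: (is_derive_eq h).
  rewrite !mxE /= !mulrfctE -![_ *: _]/(_ * _).
  by field.
apply/funext => y; rewrite !mxE expr2 -[LHS]/(A y 0 i / log_arg (X y)
  - alpha * dotp (A y) q * X y 0 i / (log_arg (X y) * log_arg (X y))).
by rewrite [X in X - _]mulrC mulrAC.
Qed.

End Gradient.

(** * Maps of class C^k and their composition with curves *)

Lemma eq_Ck (R : realType) (V W : normedModType R) (k : nat) (U : set V)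
    (F G : V -> W) :
  open U -> (forall x, U x -> F x = G x) -> Ck k U F -> Ck k U G.
Proof.
move=> oU; have near_eq (F' G' : V -> W) : (forall x, U x -> F' x = G' x) ->
    forall x, U x -> \forall y \near x, F' y = G' y.
  by move=> FG x Ux; apply: filterS (open_nbhs_nbhs (conj oU Ux)) => y /FG.
have cont (F' G' : V -> W) : (forall x, U x -> F' x = G' x) ->
    (forall x, U x -> {for x, continuous F'}) ->
    forall x, U x -> {for x, continuous G'}.
  move=> FG cF x Ux; rewrite /prop_for /continuous_at -(FG x Ux).
  by apply: cvg_trans (cF x Ux); apply: near_eq_cvg; exact: near_eq.
elim: k F G => [|k IH] F G FG [cF dF]; first by split=> //; exact: cont cF.
split; first exact: cont cF.
move=> v; have [dFv cFv] := dF v; split.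
  by move=> x Ux; apply: (near_eq_derivable (near_eq _ _ FG x Ux)); exact: dFv.
by apply: IH cFv => x Ux; apply: near_eq_derive; exact: near_eq.
Qed.

Lemma Ck_coord (R : realType) (V : normedModType R) (m n : nat) (k : nat)
    (U : set V) (F : V -> 'M[R]_(m, n)) i j :
  open U -> Ck k U F -> Ck k U (fun x => F x i j).
Proof.
move=> oU; elim: k F => [|k IH] F [cF dF]; split => //.
- move=> x Ux; apply: (@continuous_comp _ _ _ F (fun A : 'M[R]_(m, n) => A i j)).
    exact: cF.
  exact: coord_continuous.
- move=> x Ux; apply: (@continuous_comp _ _ _ F (fun A : 'M[R]_(m, n) => A i j)).
    exact: cF.
  exact: coord_continuous.
move=> v; have [dFv cFv] := dF v; split=> [x Ux|].
  by have /derivable_mxP := dFv x Ux; exact.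
apply: (eq_Ck oU _ (IH _ cFv)) => x Ux.
by rewrite derive_mx ?mxE//; exact: dFv.
Qed.

Lemma Ck1_differentiable (R : realType) (n : nat) (U : set 'rV[R]_n)
    (F : 'rV[R]_n -> R) (x : 'rV[R]_n) :
  open U -> U x -> Ck 1 U F -> differentiable F x.
Proof.
move=> oU Ux [_ dF].
have [] // := @C1_differentiable _ _ F U x oU Ux.
- by move=> i; have [] := dF (delta_mx 0 i).
- by move=> i; have [_ [cD _]] := dF (delta_mx 0 i); exact: cD.
Qed.

Lemma Ck1_differentiable_row (R : realType) (n m : nat) (U : set 'rV[R]_n)
    (F : 'rV[R]_n -> 'rV[R]_m) (x : 'rV[R]_n) :
  open U -> U x -> Ck 1 U F -> differentiable F x.
Proof.
move=> oU Ux cF.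
have -> : F = \sum_(j < m) (fun y => F y 0 j *: delta_mx 0 j).
  by apply/funext => y; rewrite fct_sumE [LHS]row_sum_delta.
apply: differentiable_sum => j; apply: differentiableZl.
exact: (Ck1_differentiable oU Ux (Ck_coord 0 j oU cF)).
Qed.

Lemma is_derive_comp_diff (R : realType) (V W : normedModType R)
    (F : V -> W) (y : R -> V) (t : R) (dy : V) :
  differentiable F (y t) -> is_derive t 1 y dy ->
  is_derive t 1 (fun s => F (y s)) ('D_dy F (y t)).
Proof.
move=> dF [dyt dyE].
have dyt' : differentiable y t by exact/derivable1_diffP.
have dFy : differentiable (F \o y) t by exact: differentiable_comp.
apply: DeriveDef; first exact: (diff_derivable dFy).
rewrite (deriveE _ dFy) diff_comp//= -(deriveE _ dyt') dyE.
by rewrite deriveE.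
Qed.

(** Near [t] the derivative of [F (y s)] is the sum of the products of [dy s 0 i] with the [i]-th
    partial of [F] at [y s]. Both factors are derivable at [t], the second because the partials of
    [F] are C^1. *)
Lemma derivable_derive_comp (R : realType) (n : nat) (U : set 'rV[R]_n)
    (F : 'rV[R]_n -> R) (I : set R) (y dy : R -> 'rV[R]_n) (t : R) :
  open U -> Ck 2 U F -> open I -> I t ->
  (forall s, I s -> U (y s)) -> (forall s, I s -> is_derive s 1 y (dy s)) ->
  derivable dy t 1 ->
  derivable ('D_1 (fun s => F (y s))) t 1.
Proof.
move=> oU [cF dF] oI It Uy hy hdy.
have cF1 : Ck 1 U F by split=> // v; have [? [? _]] := dF v; split.
have E : \forall s \near t, \sum_(i < n) dy s 0 i * 'D_(delta_mx 0 i) F (y s)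
    = 'D_1 (fun s => F (y s)) s.
  near=> s; have Is : I s by near: s; exact: open_nbhs_nbhs.
  have dFs := Ck1_differentiable oU (Uy s Is) cF1.
  have [_ ->] := is_derive_comp_diff dFs (hy s Is).
  have [] // := @C1_differentiable _ _ F U (y s) oU (Uy s Is).
  - by move=> i; have [] := dF (delta_mx 0 i).
  - by move=> i; have [_ [cD _]] := dF (delta_mx 0 i); exact: cD (Uy s Is).
apply: (near_eq_derivable E).
rewrite (_ : (fun s => _) = \sum_(i < n)
    ((fun s => dy s 0 i) * (fun s => 'D_(delta_mx 0 i) F (y s)))); last first.
  by apply/funext => s; rewrite fct_sumE.
apply: derivable_sum => i; apply: derivableM.
  by move/derivable_mxP : hdy; exact.
have [_ cD] := dF (delta_mx 0 i).
have [] // := is_derive_comp_diff (Ck1_differentiable oU (Uy t It) cD) (hy t It).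
Unshelve. all: by end_near. Qed.

Lemma derivable_derive_comp_row (R : realType) (n m : nat) (U : set 'rV[R]_n)
    (F : 'rV[R]_n -> 'rV[R]_m) (I : set R) (y dy : R -> 'rV[R]_n) (t : R) :
  open U -> Ck 2 U F -> open I -> I t ->
  (forall s, I s -> U (y s)) -> (forall s, I s -> is_derive s 1 y (dy s)) ->
  derivable dy t 1 ->
  derivable ('D_1 (fun s => F (y s))) t 1.
Proof.
move=> oU cF oI It Uy hy hdy; apply/derivable_mxP => i j; rewrite ord1.
have cF1 : Ck 1 U F.
  by have [c0 dF] := cF; split=> // v; have [? [? _]] := dF v; split.
have := derivable_derive_comp oU (Ck_coord 0 j oU cF) oI It Uy hy hdy.
apply: near_eq_derivable; near=> s.
have Is : I s by near: s; exact: open_nbhs_nbhs.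
have [d _] := is_derive_comp_diff (Ck1_differentiable_row oU (Uy s Is) cF1) (hy s Is).
by rewrite derive_mx ?mxE.
Unshelve. all: by end_near. Qed.

(** * Dot-product algebra and nondegeneracy of [dqgrad] and of the Jacobian *)

Lemma dotpC (R : realType) (n : nat) (u v : 'rV[R]_n) : dotp u v = dotp v u.
Proof. by apply: eq_bigr => i _; rewrite mulrC. Qed.

Lemma dotpDl (R : realType) (n : nat) (u v w : 'rV[R]_n) :
  dotp (u + v) w = dotp u w + dotp v w.
Proof. by rewrite /dotp -big_split; apply: eq_bigr => i _; rewrite mxE mulrDl. Qed.

Lemma dotpZl (R : realType) (n : nat) (a : R) (u w : 'rV[R]_n) :
  dotp (a *: u) w = a * dotp u w.
Proof. by rewrite /dotp mulr_sumr; apply: eq_bigr => i _; rewrite mxE mulrA. Qed.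

Lemma dotpNl (R : realType) (n : nat) (u w : 'rV[R]_n) :
  dotp (- u) w = - dotp u w.
Proof. by rewrite -scaleN1r dotpZl mulN1r. Qed.

Lemma dotp0l (R : realType) (n : nat) (w : 'rV[R]_n) : dotp 0 w = 0.
Proof. by rewrite -(scale0r (0 : 'rV_n)) dotpZl mul0r. Qed.

Lemma linear_row_sum (R : realType) (n : nat) (g : 'rV[R]_n -> R) (u : 'rV[R]_n) :
  linear g -> \sum_(i < n) u 0 i * g (delta_mx 0 i) = g u.
Proof.
move=> g_lin; pose gM := GRing.isLinear.Build _ _ _ _ _ g_lin.
pose gL : {linear 'rV[R]_n -> R} := HB.pack g gM.
rewrite -[RHS]/(gL u) [in RHS](row_sum_delta u) linear_sum.
by apply: eq_bigr => i _; rewrite linearZ.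
Qed.

Section GradientAlgebra.
Variables (R : realType) (n : nat) (alpha : R) (q x : 'rV[R]_n).

Lemma dqgrad_linear (e : 'rV[R]_n) :
  linear (fun v => dotp (dqgrad alpha q x v) e).
Proof.
move=> a u v; rewrite /dqgrad !(dotpDl, dotpNl, dotpZl) -[_ *: _]/(_ * _).
ring.
Qed.

Lemma d2qgrad_linearl (v e : 'rV[R]_n) :
  linear (fun u => dotp (d2qgrad alpha q x u v) e).
Proof.
move=> a u w; rewrite /d2qgrad !(dotpDl, dotpNl, dotpZl) -[_ *: _]/(_ * _).
ring.
Qed.

Lemma d2qgrad_linearr (u e : 'rV[R]_n) :
  linear (fun v => dotp (d2qgrad alpha q x u v) e).
Proof.
move=> a v w; rewrite /d2qgrad !(dotpDl, dotpNl, dotpZl) -[_ *: _]/(_ * _).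
ring.
Qed.

(** Since [log_arg x - alpha * dotp x q = 1], pairing [dqgrad x v] with [q] gives
    [dotp v q / log_arg x ^+ 2]. If this vanishes, [dqgrad x v] reduces to a nonzero multiple of
    [v]. *)
Lemma dqgrad_inj (v : 'rV[R]_n) :
  log_arg alpha q x != 0 -> dqgrad alpha q x v = 0 -> v = 0.
Proof.
move=> w0 dv; have vq : dotp v q = 0.
  have : dotp (dqgrad alpha q x v) q = 0 by rewrite dv dotp0l.
  rewrite /dqgrad !(dotpDl, dotpNl, dotpZl) => e.
  have -> : dotp v q = log_arg alpha q x ^+ 2 * ((log_arg alpha q x)^-1 * dotp v q
      - alpha * dotp v q / log_arg alpha q x ^+ 2 * dotp x q).
    rewrite /log_arg in w0 *; field; exact: w0.
  by rewrite e mulr0.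
move: dv; rewrite /dqgrad vq mulr0 mul0r scale0r subr0 => /eqP.
by rewrite scaler_eq0 invr_eq0 (negbTE w0) => /eqP.
Qed.

End GradientAlgebra.

(** Differentiating [h (f y) = y] near [x] exhibits the Jacobian of [h] as an inverse. *)
Lemma jacobian_diffeo_unit (R : realType) (n : nat) (U : set 'rV[R]_n)
    (f : 'rV[R]_n -> 'rV[R]_n) (x : 'rV[R]_n) :
  open U -> U x -> diffeo_onto_range U f -> jacobian f x \in unitmx.
Proof.
move=> oU Ux [smf ofU [h [smh hK]]].
have df : differentiable f x := Ck1_differentiable_row oU Ux (smf 1%N).
have dh : differentiable h (f x).
  by apply: (Ck1_differentiable_row ofU _ (smh 1%N)); exists x.
have dhf : differentiable (h \o f) x by exact: differentiable_comp.
suff JJ : jacobian f x *m jacobian h (f x) = 1%:M.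
  have [uJ _] := mulmx1_unit JJ; exact: uJ.
apply/row_matrixP => i; rewrite row_mul rowE -deriveEjacobian// -deriveEjacobian//.
rewrite deriveE// [X in 'd h _ X]deriveE// -[LHS]/(('d h (f x) \o 'd f x) _).
rewrite -diff_comp// -deriveE// rowE mulmx1.
rewrite -[RHS](derive_id x); apply: near_eq_derive.
by apply: filterS (open_nbhs_nbhs (conj oU Ux)) => y Uy /=; rewrite hK ?inE.
Qed.

(** The partial derivatives of [f] at [x] form a basis. This is how the Jacobian of [f] is cancelled
    from identities about the metric and the Christoffel symbols. *)
Lemma dotp_jacobian_inj (R : realType) (n : nat) (U : set 'rV[R]_n)
    (f : 'rV[R]_n -> 'rV[R]_n) (x e : 'rV[R]_n) :
  open U -> U x -> diffeo_onto_range U f ->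
  (forall i, dotp e ('D_(delta_mx 0 i) f x) = 0) -> e = 0.
Proof.
move=> oU Ux hf he; have uJ := jacobian_diffeo_unit oU Ux hf.
have [smf _ _] := hf.
have df : differentiable f x := Ck1_differentiable_row oU Ux (smf 1%N).
have eJ : e *m (jacobian f x)^T = 0.
  apply/rowP => i; rewrite !mxE -[RHS](he i); apply: eq_bigr => j _.
  by rewrite deriveEjacobian// -rowE !mxE.
by rewrite -(mulmxK (_ : (jacobian f x)^T \in unitmx) e) ?unitmx_tr// eJ mul0mx.
Qed.

Lemma orthant_open (R : realType) (n : nat) : open (@orthant R n).
Proof.
rewrite openE => x x0.
have near_gt i : \forall y \near x, 0 < (y : 'rV[R]_n) 0 i.
  by have /cvgr_gt := @coord_continuous R 1 n 0 i x; apply; exact: x0.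
exact: filter_forall near_gt.
Qed.

Lemma log_arg_gt0 (R : realType) (n : nat) (alpha : R) (q x : 'rV[R]_n) :
  0 < alpha -> orthant q -> orthant x -> 0 < log_arg alpha q x.
Proof.
move=> a0 q0 x0; apply: ltr_wpDr; last exact: ltr01.
apply: mulr_ge0; first exact: ltW.
by apply: sumr_ge0 => i _; apply: mulr_ge0; apply: ltW; [exact: x0|exact: q0].
Qed.

(** * The c-transform on the range of the transport map *)

Section Transport.
Variables (R : realType) (n : nat) (M : set 'rV[R]_n) (c : 'rV[R]_n -> 'rV[R]_n -> R).
Variables (phi : 'rV[R]_n -> R) (f : 'rV[R]_n -> 'rV[R]_n).
Hypothesis hot : optimal_transport M M c phi f.

Lemma transport_range p : M p -> M (f p).
Proof.
by case: hot => _ _ /(_ p) + _ => /[apply] /seteqP[_ /(_ (f p) erefl) []].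
Qed.

(** The contact equality at [(p, f p)] has a finite right-hand side, so the c-transform is finite
    there and [fine] does not fall back on its default value. *)
Lemma transport_c_transform p :
  M p -> fine (c_transform M c phi (f p)) = c p (f p) - phi p.
Proof.
case: hot => _ _ /(_ p) + _ => /[apply] /seteqP[_ /(_ (f p) erefl) [_]].
by case: (c_transform _ _ _ _) => [r| |] //= [<-]; rewrite addrAC subrr add0r.
Qed.

End Transport.

(** * Metric, Christoffel symbols and primal geodesics for the logarithmic cost *)

Section LogarithmicCost.
Variables (R : realType) (n : nat) (alpha : R) (phi : 'rV[R]_n -> R).
Variable f : 'rV[R]_n -> 'rV[R]_n.
Hypothesis alpha_gt0 : 0 < alpha.
Let M := @orthant R n.
Hypothesis hot : optimal_transport M M (log_cost alpha) phi f.
Let D := in_coords f (c_divergence M (log_cost alpha) phi).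

Let f_diff p : M p -> differentiable f p.
Proof.
have [_ _ _ [smf _ _]] := hot => Mp.
exact: Ck1_differentiable_row (@orthant_open R n) Mp (smf 1%N).
Qed.

Let log_arg_neq0 x p : M x -> M p -> log_arg alpha (f p) x != 0.
Proof.
by move=> Mx Mp; rewrite gt_eqF// log_arg_gt0//; exact: transport_range hot _ Mp.
Qed.

Lemma partial_divergence k xi : M xi -> exists K, forall x, M x ->
  partial k (fun x' => D x x') xi
  = dotp (qgrad alpha (f xi) x) ('D_(delta_mx 0 k) f xi) + K.
Proof.
move=> Mxi; pose d : 'rV[R]_n := delta_mx 0 k.
pose psi (x' : 'rV[R]_n) := log_cost alpha x' (f x') - phi x'.
have a0 : alpha != 0 by rewrite gt_eqF.
have hf : is_derive xi d f ('D_d f xi) by apply/derivableP/diff_derivable/f_diff.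
have w0 x : M x -> 0 < 1 + alpha * dotp x (f xi).
  by move=> Mx; apply: log_arg_gt0 => //; exact: transport_range hot _ Mxi.
have dpsi : derivable psi xi d.
  apply: derivableB.
    by have [] := is_derive_log_cost a0 (w0 _ Mxi) (is_derive_id xi d) hf.
  by have [smphi _ _ _] := hot; have [_ /(_ d) []] := smphi 1%N => + _; exact.
exists (- 'D_d psi xi) => x Mx; rewrite /partial.
have hc := is_derive_log_cost a0 (w0 _ Mx) (is_derive_cst x xi d) hf.
have E : \forall x' \near xi, log_cost alpha x (f x') - phi x - psi x' = D x x'.
  apply: filterS (open_nbhs_nbhs (conj (@orthant_open R n) Mxi)) => x' Mx'.
  by rewrite /D /in_coords /c_divergence /= (transport_c_transform hot).
rewrite -(near_eq_derive _ E).
have h := is_deriveB (is_deriveB hc (is_derive_cst (phi x) xi d)) (derivableP dpsi).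
have [_ ->] := h.
by rewrite subr0 dotp0l add0r /qgrad dotpZl mulrC.
Qed.

Lemma metricE xi i j : M xi ->
  metric D xi i j
  = - dotp (dqgrad alpha (f xi) xi (delta_mx 0 i)) ('D_(delta_mx 0 j) f xi).
Proof.
move=> Mxi; rewrite mxE; congr (- _); have [K DK] := partial_divergence j Mxi.
have E : \forall x \near xi,
    dotp (qgrad alpha (f xi) x) ('D_(delta_mx 0 j) f xi) + K
    = partial j (fun x' => D x x') xi.
  by apply: filterS (open_nbhs_nbhs (conj (@orthant_open R n) Mxi)) => x /DK.
rewrite /partial -(near_eq_derive _ E).
have h := is_deriveD (is_derive_dotpl ('D_(delta_mx 0 j) f xi)
  (is_derive_qgrad (log_arg_neq0 Mxi Mxi) (is_derive_id xi (delta_mx 0 i))))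
  (is_derive_cst K xi (delta_mx 0 i)).
by have [_ ->] := h; rewrite addr0.
Qed.

(** The dual point [f xi] stays fixed while [x] moves, so both derivatives in [x] fall on [qgrad]
    and no second derivative of [f] appears. *)
Lemma Gamma_lowE xi i j k : M xi ->
  Gamma_low D xi i j k
  = - dotp (d2qgrad alpha (f xi) xi (delta_mx 0 i) (delta_mx 0 j))
           ('D_(delta_mx 0 k) f xi).
Proof.
move=> Mxi; congr (- _); have [K DK] := partial_divergence k Mxi.
have E : \forall x \near xi,
    dotp (dqgrad alpha (f xi) x (delta_mx 0 j)) ('D_(delta_mx 0 k) f xi)
    = partial j (fun x => partial k (fun x' => D x x') xi) x.
  apply: filterS (open_nbhs_nbhs (conj (@orthant_open R n) Mxi)) => x Mx.
  have Ex : \forall y \near x,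
      dotp (qgrad alpha (f xi) y) ('D_(delta_mx 0 k) f xi) + K
      = partial k (fun x' => D y x') xi.
    by apply: filterS (open_nbhs_nbhs (conj (@orthant_open R n) Mx)) => y /DK.
  rewrite [RHS]/partial -(near_eq_derive _ Ex).
  have h := is_deriveD (is_derive_dotpl ('D_(delta_mx 0 k) f xi)
    (is_derive_qgrad (log_arg_neq0 Mx Mxi) (is_derive_id x (delta_mx 0 j))))
    (is_derive_cst K x (delta_mx 0 j)).
  by have [_ ->] := h; rewrite addr0.
rewrite [LHS]/partial -(near_eq_derive _ E).
have h := is_derive_dotpl ('D_(delta_mx 0 k) f xi)
  (is_derive_dqgrad (log_arg_neq0 Mxi Mxi) (is_derive_id xi (delta_mx 0 i))
    (is_derive_cst (delta_mx 0 j) xi (delta_mx 0 i))).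
have [_ ->] := h; congr dotp.
by rewrite /dqgrad scaler0 dotp0l mulr0 mul0r scale0r subr0 add0r.
Qed.

Lemma metric_pairingE xi u v : M xi ->
  metric_pairing D xi u v = - dotp (dqgrad alpha (f xi) xi u) ('D_v f xi).
Proof.
move=> Mxi; rewrite /metric_pairing.
have inner i : \sum_(j < n) metric D xi i j * u 0 i * v 0 j
    = u 0 i * - dotp (dqgrad alpha (f xi) xi (delta_mx 0 i)) ('D_v f xi).
  pose g w := - dotp (dqgrad alpha (f xi) xi (delta_mx 0 i)) ('D_w f xi).
  have g_lin : linear g.
    move=> a w w'; rewrite /g !(deriveEjacobian _ (f_diff Mxi)).
    rewrite mulmxDl -scalemxAl.
    by rewrite ![dotp (dqgrad _ _ _ _) _]dotpC dotpDl dotpZl opprD -mulrN.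
  rewrite -[X in _ * X]/(g v) -(linear_row_sum v g_lin) mulr_sumr.
  by apply: eq_bigr => j _; rewrite metricE// /g; ring.
under eq_bigr do rewrite inner.
rewrite -[RHS]mulN1r -(linear_row_sum u (dqgrad_linear alpha (f xi) xi ('D_v f xi))).
by rewrite mulr_sumr; apply: eq_bigr => i _; ring.
Qed.

(** A row [u] in the kernel makes [dqgrad xi u] orthogonal to all partials of [f], hence zero, and
    then [u = 0]. Thus [invmx] in the Christoffel symbols is a genuine inverse. *)
Lemma metric_unit xi : M xi -> metric D xi \in unitmx.
Proof.
move=> Mxi; rewrite -row_free_unit; apply: inj_row_free => u ug.
apply: (dqgrad_inj (log_arg_neq0 Mxi Mxi)).
have [_ _ _ hf] := hot; apply: (dotp_jacobian_inj (@orthant_open R n) Mxi hf) => j.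
have /rowP/(_ j) := ug; rewrite !mxE => e.
rewrite -(linear_row_sum u (dqgrad_linear alpha (f xi) xi _)).
apply: oppr_inj; rewrite oppr0 -[RHS]e -sumrN.
by apply: eq_bigr => i _; rewrite metricE// mulrN.
Qed.

(* For xi, v, a the position, velocity and acceleration of a primal geodesic x,
   this is the vanishing of the second derivative of s |-> qgrad (x s), the dual
   point being held fixed at f xi. *)
Lemma geodesic_qgrad (xi v a : 'rV[R]_n) : M xi ->
  (forall k, a 0 k + \sum_(i < n) \sum_(j < n)
     Gamma D xi i j k * v 0 i * v 0 j = 0) ->
  dqgrad alpha (f xi) xi a + d2qgrad alpha (f xi) xi v v = 0.
Proof.
move=> Mxi geo; have [_ _ _ hf] := hot.
apply: (dotp_jacobian_inj (@orthant_open R n) Mxi hf) => m.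
pose Y : 'rV[R]_n := \row_m
  \sum_(i < n) \sum_(j < n) Gamma_low D xi i j m * v 0 i * v 0 j.
(* The geodesic equation in matrix form; multiplying by the metric on the right lowers the index
   again. *)
have aY : a + Y *m invmx (metric D xi) = 0.
  apply/rowP => k; rewrite !mxE -[RHS](geo k); congr (_ + _).
  transitivity (\sum_(m < n) \sum_(i < n) \sum_(j < n)
      Gamma_low D xi i j m * invmx (metric D xi) m k * v 0 i * v 0 j).
    apply: eq_bigr => l _; rewrite mxE mulr_suml; apply: eq_bigr => i _.
    by rewrite mulr_suml; apply: eq_bigr => j _; ring.
  rewrite exchange_big; apply: eq_bigr => i _.
  rewrite exchange_big; apply: eq_bigr => j _.
  by rewrite /Gamma !mulr_suml.
have : a *m metric D xi + Y = 0.
  by rewrite -(mulmxKV (metric_unit Mxi) Y) -mulmxDl aY mul0mx.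
move=> /rowP/(_ m); rewrite !mxE => e.
apply: oppr_inj; rewrite oppr0 -[RHS]e dotpDl opprD; congr (_ + _).
  rewrite -(linear_row_sum a (dqgrad_linear alpha (f xi) xi _)) -sumrN.
  by apply: eq_bigr => i _; rewrite metricE// mulrN.
rewrite -(linear_row_sum v (d2qgrad_linearl alpha (f xi) xi v _)) -sumrN.
apply: eq_bigr => i _.
rewrite -(linear_row_sum v (d2qgrad_linearr alpha (f xi) xi (delta_mx 0 i) _)).
rewrite mulr_sumr -sumrN; apply: eq_bigr => j _.
by rewrite Gamma_lowE//; ring.
Qed.

End LogarithmicCost.

(** * Second derivatives along curves and the mixed fourth derivative *)

Lemma derive1n2_near (R : realType) (V : normedModType R) (F A A1 : R -> V)
    (I : set R) (t : R) (A2 : V) :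
  open I -> I t -> (forall s, I s -> F s = A s) ->
  (forall s, I s -> is_derive s 1 A (A1 s)) -> is_derive t 1 A1 A2 ->
  derive1n 2 F t = A2.
Proof.
move=> oI It FA hA [_ <-]; rewrite -[LHS]/(derive1 (derive1 F) t) derive1E.
have near_I (s : R) : I s -> \forall r \near s, I r.
  by move=> Is; exact: (open_nbhs_nbhs (conj oI Is)).
(* Derivatives are local and [I] is open, so agreement on [I] suffices; this is used once for each
   order. *)
apply: near_eq_derive; apply: filterS (near_I _ It) => s Is.
have [_ <-] := hA _ Is; rewrite derive1E; apply: near_eq_derive.
by apply: filterS (near_I _ Is) => r /FA.
Qed.

Lemma smooth_curve_derivable (R : realType) (V : normedModType R) (I : set R)
    (x : R -> V) (s : R) :
  smooth_on I x -> I s ->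
  is_derive s 1 x (derive1 x s) /\ derivable (derive1 x) s 1.
Proof.
move=> /(_ 2%N) [_ /(_ 1) [dx [_ /(_ 1) [ddx _]]]] Is.
have -> : derive1 x = 'D_1 x by apply/funext => r; rewrite derive1E.
split; first exact/derivableP/dx.
exact: ddx.
Qed.

Theorem corollary2 (R : realType) (n : nat) (hn : (2 <= n)%N)
    (alpha : R) (halpha : 0 < alpha)
    (phi : 'rV[R]_n -> R) (f : 'rV[R]_n -> 'rV[R]_n)
    (hot : optimal_transport (@orthant R n) (@orthant R n) (log_cost alpha)
             phi f)
    (I J : set R) (gamma sigma : R -> 'rV[R]_n * 'rV[R]_n) :
  let D := c_divergence (@orthant R n) (log_cost alpha) phi in
  let Dxi := in_coords f D in
  geodesic_in_graph (@orthant R n) f (Gamma Dxi) I gamma ->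
  geodesic_in_graph (@orthant R n) f (Gamma_dual Dxi) J sigma ->
  I 0 -> J 0 -> gamma 0 = sigma 0 ->
  derive1n 2 (fun s : R => derive1n 2 (fun t : R => D (gamma s) (sigma t)) 0) 0
  = - 2 * alpha *
    metric_pairing Dxi (gamma 0).1
      (derive1 (fun s : R => (gamma s).1) 0)
      (derive1 (fun t : R => (sigma t).1) 0) ^+ 2.
Proof.
move=> D Dxi [oI _ gI [smx geo]] [oJ _ sJ [smy _]] I0 J0 gs0.
pose M := @orthant R n; pose x s := (gamma s).1; pose y t := (sigma t).1.
have Mx s : I s -> M (x s) by move=> /gI [p Mp e]; rewrite /x -e.
have My t : J t -> M (y t) by move=> /sJ [p Mp e]; rewrite /y -e.
have sE t : J t -> (sigma t).2 = f (y t) by move=> /sJ [p Mp e]; rewrite /y -e.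
have xy0 : x 0 = y 0 by rewrite /x gs0.
have a0 : alpha != 0 by rewrite gt_eqF.
have oM : open M := @orthant_open R n.
have [smphi _ _ [smf _ _]] := hot.
have hx s : I s -> is_derive s 1 x (derive1 x s).
  by move=> Is; have [] := smooth_curve_derivable smx Is.
have hy t : J t -> is_derive t 1 y (derive1 y t).
  by move=> Jt; have [] := smooth_curve_derivable smy Jt.
have [_ dx1] := smooth_curve_derivable smx I0.
have [_ dy1] := smooth_curve_derivable smy J0.
pose q t := f (y t); pose q1 := 'D_1 q; pose q2 := 'D_1 q1 0.
have hq t : J t -> is_derive t 1 q (q1 t).
  move=> Jt; apply: derivableP.
  by have [] := is_derive_comp_diff
    (Ck1_differentiable_row oM (My t Jt) (smf 1%N)) (hy t Jt).
have q1E : q1 0 = 'D_(derive1 y 0) f (x 0).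
  have [_] := is_derive_comp_diff
    (Ck1_differentiable_row oM (My 0 J0) (smf 1%N)) (hy 0 J0).
  by rewrite xy0.
have hq1 : is_derive (0 : R) 1 q1 q2.
  by apply: derivableP; exact: (derivable_derive_comp_row oM (smf 2%N) oJ J0 My hy dy1).
have w0 s t : I s -> J t -> 0 < 1 + alpha * dotp (x s) (q t).
  move=> Is Jt; apply: (@log_arg_gt0 R n alpha (q t) (x s)).
  - exact: halpha.
  - exact: (transport_range hot (My t Jt)).
  - exact: Mx.
have v0 t : J t -> 0 < 1 + alpha * dotp (y t) (q t).
  move=> Jt; apply: (@log_arg_gt0 R n alpha (q t) (y t)).
  - exact: halpha.
  - exact: (transport_range hot (My t Jt)).
  - exact: My.
(* The c-transform along [sigma]. Only the existence of its second derivative at [0] matters: its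
   value does not depend on [s] and disappears in the derivatives in [s]. *)
pose Psi t := log_cost alpha (y t) (q t) - phi (y t).
pose Psi1 t := (dotp (derive1 y t) (q t) + dotp (y t) (q1 t))
  / (1 + alpha * dotp (y t) (q t)) - 'D_1 (fun r => phi (y r)) t.
have hPsi t : J t -> is_derive t 1 Psi (Psi1 t).
  move=> Jt; apply: is_deriveB; first
    exact: is_derive_log_cost a0 (v0 t Jt) (hy t Jt) (hq t Jt).
  apply: derivableP.
  by have [] := is_derive_comp_diff
    (Ck1_differentiable oM (My t Jt) (smphi 1%N)) (hy t Jt).
have dPsi1 : derivable Psi1 (0 : R) 1.
  apply: derivableB; last exact: (derivable_derive_comp oM (smphi 2%N) oJ J0 My hy dy1).
  have hn1 := is_derive_dotp (derivableP dy1) (hq 0 J0).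
  have hn2 := is_derive_dotp (hy 0 J0) hq1.
  have hw := is_deriveD (is_derive_cst (1 : R) (0 : R) 1)
    (is_deriveZ alpha (is_derive_dotp (hy 0 J0) (hq 0 J0))).
  have vn : ((cst 1 : R -> R) + (alpha \*: (fun t => dotp (y t) (q t)))) 0 != 0.
    by rewrite (gt_eqF (v0 0 J0)).
  by have [] := is_derive_quotient vn (is_deriveD hn1 hn2) hw.
pose P s := qgrad alpha (q 0) (x s).
pose P1 s := dqgrad alpha (q 0) (x s) (derive1 x s).
have inner s : I s -> derive1n 2 (fun t => D (gamma s) (sigma t)) 0
    = dotp (P s) q2 - alpha * dotp (P s) (q1 0) ^+ 2 - 'D_1 Psi1 0.
  move=> Is; have wn0 t : J t -> 1 + alpha * dotp (x s) (q t) != 0.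
    by move=> Jt; rewrite (gt_eqF (w0 s t Is Jt)).
  apply: (@derive1n2_near _ _ _
    (fun t => log_cost alpha (x s) (q t) - phi (x s) - Psi t)
    (fun t => dotp (x s) (q1 t) / (1 + alpha * dotp (x s) (q t)) - Psi1 t) J _ _ oJ J0).
  - move=> t Jt; rewrite /D /c_divergence (sE t Jt).
    by rewrite (transport_c_transform hot (My t Jt)).
  - move=> t Jt; apply: is_deriveB; last exact: hPsi.
    have := is_deriveB (@is_derive_log_cost _ _ _ _ (cst (x s)) _ _ _ _ _
      a0 (w0 s t Is Jt) (is_derive_cst (x s) t 1) (hq t Jt)) (is_derive_cst (phi (x s)) t 1).
    by move=> h; apply: (is_derive_eq h); rewrite subr0 dotp0l add0r.
  - apply: is_deriveB (derivableP dPsi1).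
    have hxq : is_derive (0 : R) 1 (fun t => dotp (x s) (q t)) (dotp (x s) (q1 0)).
      have := is_derive_dotp (is_derive_cst (x s) (0 : R) 1) (hq 0 J0).
      by rewrite dotp0l add0r.
    have hxq1 : is_derive (0 : R) 1 (fun t => dotp (x s) (q1 t)) (dotp (x s) q2).
      have := is_derive_dotp (is_derive_cst (x s) (0 : R) 1) hq1.
      by rewrite dotp0l add0r.
    have hw : is_derive (0 : R) 1 (fun t => 1 + alpha * dotp (x s) (q t))
        (alpha * dotp (x s) (q1 0)).
      apply: (is_derive_eq (is_deriveD (is_derive_cst (1 : R) (0 : R) 1)
        (is_deriveZ alpha hxq))).
      by rewrite add0r.
    have h := @is_derive_quotient _ _ _ (fun t => 1 + alpha * dotp (x s) (q t))
      (0 : R) 1 _ _ (wn0 0 J0) hxq1 hw.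
    apply: (is_derive_eq h); rewrite /P /qgrad /log_arg !dotpZl.
    by field; exact: wn0.
have hP s : I s -> is_derive s 1 P (P1 s).
  move=> Is; apply: is_derive_qgrad (hx s Is).
  by rewrite (gt_eqF (w0 s 0 Is J0)).
(* The primal geodesic equation enters here; it applies because the fixed dual point [q 0] is
   [f (x 0)], the curves starting at the same point. *)
have hP1 : is_derive (0 : R) 1 P1 0.
  have wn : log_arg alpha (q 0) (x 0) != 0.
    by rewrite (gt_eqF (w0 0 0 I0 J0)).
  have := is_derive_dqgrad wn (hx 0 I0) (derivableP dx1).
  move=> h; apply: (is_derive_eq h); rewrite /q -xy0.
  apply: (geodesic_qgrad halpha hot (Mx 0 I0)) => k.
  by have := geo 0 I0 k; rewrite -derive1E.
(* The minus sign of the metric is lost in the square, so the right-hand side becomes [- 2 * alpha]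
   times the square of [dotp (P1 0) (q1 0)]. *)
rewrite (metric_pairingE halpha hot _ _ (Mx 0 I0)) sqrrN -q1E.
rewrite -[dqgrad _ _ _ _]/(dqgrad alpha (f (x 0)) (x 0) (derive1 x 0)) xy0.
rewrite -[f (y 0)]/(q 0) -xy0 -/(P1 0).
apply: (@derive1n2_near _ _ _
  (fun s => dotp (P s) q2 - alpha * dotp (P s) (q1 0) ^+ 2 - 'D_1 Psi1 0)
  (fun s => dotp (P1 s) q2 - alpha * (2 * dotp (P s) (q1 0) * dotp (P1 s) (q1 0)))
  I _ _ oI I0 inner) => [s Is|].
  have hPq := is_derive_dotpl (q1 0) (hP s Is).
  have h := is_deriveB (is_deriveB (is_derive_dotpl q2 (hP s Is))
    (is_deriveZ alpha (is_deriveM hPq hPq))) (is_derive_cst ('D_1 Psi1 0) s 1).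
  apply: (is_derive_eq h); rewrite subr0; congr (_ - _ * _).
  by rewrite -[LHS]/(_ * _ + _ * _); ring.
have hPq := is_derive_dotpl (q1 0) (hP 0 I0).
have hP1q := is_derive_dotpl (q1 0) hP1.
(* As [P1] has zero derivative at [0], the [q2] term vanishes, and so does the part of the product
   rule differentiating [P1]; only the square of [dotp (P1 0) (q1 0)] remains. *)
have h := is_deriveB (is_derive_dotpl q2 hP1)
  (is_deriveZ alpha (is_deriveM (is_deriveZ 2 hPq) hP1q)).
apply: (is_derive_eq h); rewrite !dotp0l -![_ *: _]/(_ * _).
by ring.
Qed.
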